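(* Let $A$ be an MV-algebra, $L$ a residuated lattice and $s:A\rightarrow L$ an order-preserving type I state. Consider the following statements: (1) $s$ is $\uparrow$-continuous in $1$; (2) $s$ is $\uparrow$-continuous; (3) $s$ is $\downarrow$-continuous in $0$; (4) $s$ is $\downarrow$-continuous; (5) $s$ is continuous. Then (1) is equivalent to (2), (1) implies (4), and (4) implies (3). If $L$ is involutive, then all of (1), (2), (3), (4), (5) are equivalent.
   Context: A residuated lattice is an algebra $(A,\vee,\wedge,\odot,\rightarrow,0,1)$ such that $(A,\vee,\wedge,0,1)$ is a bounded lattice, $(A,\odot,1)$ is a commutative monoid, and for all $a,b,c\in A$: $a\leq b\rightarrow c$ iff $a\odot b\leq c$. Write $\neg a=a\rightarrow 0$ and $d_A(a,b)=(a\rightarrow b)\wedge(b\rightarrow a)$. $L$ is involutive iff $\neg\neg a=a$ for all $a$. An MV-algebra is (regarded as) a residuated lattice satisfying $(a\rightarrow b)\rightarrow b=(b\rightarrow a)\rightarrow a$ for all $a,b$. A function $s:A\rightarrow L$ between residuated lattices is a type I state iff $s(0)=0$, $s(1)=1$ and $s(a\rightarrow b)=s(a)\rightarrow s(b)$ for all $a,b\in A$ with $b\leq a$. It is order-preserving iff $a\leq b$ implies $s(a)\leq s(b)$. $(c_n)_{n\geq0}\uparrow c$ means the sequence is increasing with supremum $c$; $(c_n)_{n\geq0}\downarrow c$ means it is decreasing with infimum $c$. A sequence $(x_n)_{n\geq0}\subseteq L$ converges towards $x\in L$ (written $\lim_{n\rightarrow\infty}x_n=x$) iff there is $(c_n)_{n\geq0}\subseteq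 L$ with $(c_n)\uparrow 1$ and $c_n\leq d_L(x_n,x)$ for all $n$. $s$ is $\uparrow$-continuous (respectively $\downarrow$-continuous) in $a\in A$ iff for every sequence $(a_n)\subseteq A$ with $(a_n)\uparrow a$ (respectively $(a_n)\downarrow a$) we have $\lim_{n\rightarrow\infty}s(a_n)=s(a)$; it is continuous in $a$ iff it is both. $s$ is $\uparrow$-continuous, $\downarrow$-continuous, continuous iff it is so in every $a\in A$. *)

(* Defs.v *)
From HB Require Import structures.
From mathcomp Require Import all_boot all_order.
From mathcomp Require Import classical_sets.

Set Implicit Arguments.
Unset Strict Implicit.
Unset Printing Implicit Defensive.

Local Open Scope order_scope.

Declare Scope residuated_scope.
Delimit Scope residuated_scope with RL.
Local Open Scope residuated_scope.

Reserved Notation "a ⊙ b" (at level 40, left associativity).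
Reserved Notation "a ⇒ b" (at level 55, right associativity).

(* The bounds 0 and 1 are \bot and \top; they are not assumed distinct. *)
HB.mixin Record isResiduated (d : Order.disp_t) (A : Type)
    of Order.TBLattice d A := {
  rmul : A -> A -> A;
  rimp : A -> A -> A;
  rmulA : associative rmul;
  rmulC : commutative rmul;
  rmul1 : left_id (\top : A) rmul;
  residuation : forall a b c : A, (a <= rimp b c) = (rmul a b <= c)
}.

#[short(type="residuatedLatticeType")]
HB.structure Definition ResiduatedLattice (d : Order.disp_t) :=
  { A of isResiduated d A & Order.TBLattice d A }.

Notation "a ⊙ b" := (rmul a b) : residuated_scope.
Notation "a ⇒ b" := (rimp a b) : residuated_scope.

Section ResiduatedLattices.
Context {d : Order.disp_t}.

Definition rneg (A : residuatedLatticeType d) (a : A) : A := a ⇒ \bot.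

Definition rdist (A : residuatedLatticeType d) (a b : A) : A :=
  (a ⇒ b) `&` (b ⇒ a).

Definition involutive_lattice (A : residuatedLatticeType d) : Prop :=
  forall a : A, rneg (rneg a) = a.

Definition is_MV_algebra (A : residuatedLatticeType d) : Prop :=
  forall a b : A, (a ⇒ b) ⇒ b = (b ⇒ a) ⇒ a.

(* Monotonicity of sequences is weak. *)
Definition seq_up (A : residuatedLatticeType d) (c : nat -> A) (x : A) : Prop :=
  {homo c : m n / (m <= n)%N >-> m <= n} /\ supremums (range c) x.

Definition seq_down (A : residuatedLatticeType d) (c : nat -> A) (x : A) :
    Prop :=
  {homo c : m n / (m <= n)%N >-> n <= m} /\ infimums (range c) x.

Definition seq_converges (L : residuatedLatticeType d) (u : nat -> L) (x : L) :
    Prop :=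
  exists c : nat -> L, seq_up c \top /\ forall n, c n <= rdist (u n) x.

End ResiduatedLattices.

Section States.
Context {d d' : Order.disp_t}.
Variables (A : residuatedLatticeType d) (L : residuatedLatticeType d').
Variable s : A -> L.

Definition type_I_state : Prop :=
  [/\ s \bot = \bot, s \top = \top &
      forall a b : A, b <= a -> s (a ⇒ b) = s a ⇒ s b].

Definition order_preserving : Prop := {homo s : a b / a <= b}.

Definition up_continuous_in (a : A) : Prop :=
  forall u : nat -> A, seq_up u a -> seq_converges (fun n => s (u n)) (s a).

Definition down_continuous_in (a : A) : Prop :=
  forall u : nat -> A, seq_down u a -> seq_converges (fun n => s (u n)) (s a).

Definition continuous_in (a : A) : Prop :=
  up_continuous_in a /\ down_continuous_in a.

Definition up_continuous : Prop := forall a : A, up_continuous_in a.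

Definition down_continuous : Prop := forall a : A, down_continuous_in a.

Definition state_continuous : Prop := forall a : A, continuous_in a.

End States.

(* Main.v *)
(** In an MV-algebra, u ↑ a implies (a ⇒ u) ↑ 1, and u ↓ a implies (u ⇒ a) ↑ 1.
    As s preserves these implications, and for x <= y the distance between x
    and y is y ⇒ x, continuity of s at 1 along (a ⇒ u) (resp. (u ⇒ a)) is
    exactly convergence of s u to s a.  When L is involutive, negation exchanges
    sequences increasing to 1 and sequences decreasing to 0. *)
Require Import Defs.
From mathcomp Require Import all_boot all_order.

Set Implicit Arguments.
Unset Strict Implicit.
Unset Printing Implicit Defensive.

Import Order.Theory.
Local Open Scope order_scope.
Local Open Scope residuated_scope.

Section ResiduatedLatticeTheory.
Context {d : Order.disp_t} {A : residuatedLatticeType d}.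
Implicit Types a b c : A.

Lemma rimp_top a b : (a ⇒ b == \top) = (a <= b).
Proof. by rewrite -le1x residuation rmul1. Qed.

Lemma rimpxx a : a ⇒ a = \top.
Proof. by apply/eqP; rewrite rimp_top. Qed.

Lemma top_rimp a : \top ⇒ a = a.
Proof.
apply/le_anti/andP; split; last by rewrite residuation rmulC rmul1.
by rewrite -[X in X <= _](rmul1 (\top ⇒ a)) rmulC -residuation.
Qed.

Lemma rmul_rimp_le a b : a ⊙ (a ⇒ b) <= b.
Proof. by rewrite rmulC -residuation. Qed.

Lemma le_rmul2l a b c : b <= c -> a ⊙ b <= a ⊙ c.
Proof. by move=> bc; rewrite rmulC -residuation (le_trans bc)// residuation rmulC. Qed.

Lemma le_rimp2l a b c : b <= c -> a ⇒ b <= a ⇒ c.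
Proof. by move=> bc; rewrite residuation rmulC (le_trans (rmul_rimp_le _ _)). Qed.

Lemma le_rimp2r a b c : a <= b -> b ⇒ c <= a ⇒ c.
Proof.
move=> ab; rewrite residuation.
by rewrite (le_trans (le_rmul2l _ ab))// -residuation.
Qed.

Lemma rimp_ge a b : b <= a ⇒ b.
Proof. by rewrite -[X in X <= _]top_rimp le_rimp2r// lex1. Qed.

Lemma rimp_rmul a b c : a ⊙ b ⇒ c = a ⇒ (b ⇒ c).
Proof.
apply/le_anti/andP; split; first by rewrite !residuation -rmulA -residuation.
by rewrite residuation rmulA -!residuation.
Qed.

Lemma rimpCA a b c : a ⇒ (b ⇒ c) = b ⇒ (a ⇒ c).
Proof. by rewrite -!rimp_rmul rmulC. Qed.

Lemma rdist_le a b : a <= b -> rdist a b = b ⇒ a.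
Proof. by rewrite -rimp_top /rdist => /eqP ->; rewrite meet1x. Qed.

Lemma rdistC a b : rdist a b = rdist b a.
Proof. exact: meetC. Qed.

Lemma seq_up_top (c : nat -> A) :
  {homo c : m n / (m <= n)%N >-> m <= n} ->
  (forall x, (forall n, c n <= x) -> x = \top) -> seq_up c \top.
Proof.
move=> cmono csup; split=> //; split; first by move=> x _; exact: lex1.
by move=> x ubx; rewrite (csup x)// => n; apply: ubx; exists n.
Qed.

Lemma seq_up_ge (c : nat -> A) a n : seq_up c a -> c n <= a.
Proof. by move=> [_ [uba _]]; apply: uba; exists n. Qed.

Lemma seq_up_le (c : nat -> A) a b :
  seq_up c a -> (forall n, c n <= b) -> a <= b.
Proof. by move=> [_ [_ lba]] cb; apply: lba => _ [n _ <-]; exact: cb. Qed.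

Lemma seq_down_le (c : nat -> A) a n : seq_down c a -> a <= c n.
Proof. by move=> [_ [lba _]]; apply: lba; exists n. Qed.

Lemma seq_down_ge (c : nat -> A) a b :
  seq_down c a -> (forall n, b <= c n) -> b <= a.
Proof. by move=> [_ [_ uba]] cb; apply: uba => _ [n _ <-]; exact: cb. Qed.

(** Residuation makes [x <= rneg (c n)] and [c n <= rneg x] the same, so a lower bound [x] of the
    negations satisfies [\top <= rneg x], that is, [x <= \bot]. *)
Lemma seq_down_neg (c : nat -> A) :
  seq_up c \top -> seq_down (fun n => rneg (c n)) \bot.
Proof.
move=> c1; split; first by move=> m n mn; apply: le_rimp2r; exact: c1.1.
split; first by move=> x _; exact: le0x.
move=> x lbx; rewrite -(top_rimp \bot) residuation rmulC -residuation.
apply: (seq_up_le c1) => n.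
by rewrite residuation rmulC -residuation; apply: lbx; exists n.
Qed.

End ResiduatedLatticeTheory.

Section MVAlgebraTheory.
Context {d : Order.disp_t} {A : residuatedLatticeType d}.
Hypothesis A_MV : is_MV_algebra A.
Implicit Types a b c : A.

Lemma MV_rimpK a b : b <= a -> (a ⇒ b) ⇒ b = a.
Proof. by rewrite A_MV -rimp_top => /eqP ->; rewrite top_rimp. Qed.

Lemma MV_rnegK a : rneg (rneg a) = a.
Proof. by rewrite /rneg MV_rimpK// le0x. Qed.

Lemma MV_rimp_neg a b : rneg b ⇒ rneg a = a ⇒ b.
Proof. by rewrite [in LHS]/rneg rimpCA -[in RHS](MV_rnegK b). Qed.

(** Both sides have the same negation: currying and contraposition turn that of the left side into
    [(rneg b ⇒ rneg a) ⇒ rneg a], which is [rneg b] because [rneg a <= rneg b]. *)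
Lemma MV_divisible a b : b <= a -> a ⊙ (a ⇒ b) = b.
Proof.
move=> ba; rewrite -[LHS]MV_rnegK -[RHS]MV_rnegK; congr rneg.
rewrite {1}/rneg rmulC rimp_rmul -/(rneg a) -(MV_rimp_neg a b) MV_rimpK//.
exact: le_rimp2r.
Qed.

(** A cancellation law: since [rneg c <= a], divisibility gives [rneg c = a ⊙ (a ⇒ rneg c) = a ⊙
    rneg (a ⊙ c) = a ⊙ rneg a = \bot]. *)
Lemma MV_rmul_fixed a c : rneg a <= c -> a ⊙ c = a -> c = \top.
Proof.
move=> nac aca.
have nca : rneg c <= a by rewrite -[a]MV_rnegK; exact: le_rimp2r.
suff nc0 : rneg c = \bot by rewrite -[c]MV_rnegK nc0 /rneg rimpxx.
apply/eqP; rewrite -lex0 -(MV_divisible nca) /rneg -rimp_rmul aca.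
exact: rmul_rimp_le.
Qed.

(** An upper bound [c] of the implications satisfies [u n = a ⊙ (a ⇒ u n) <= a ⊙ c], hence
    [a <= a ⊙ c], and cancellation forces [c = \top]. *)
Lemma MV_seq_up_rimp (u : nat -> A) a :
  seq_up u a -> seq_up (fun n => a ⇒ u n) \top.
Proof.
move=> ua; apply: seq_up_top => [m n mn|c uc].
  by apply: le_rimp2l; exact: ua.1.
apply: (@MV_rmul_fixed a).
  by apply: le_trans (uc 0%N); apply: le_rimp2l; exact: le0x.
apply/le_anti/andP; split.
  by rewrite -[X in _ <= X]rmul1 rmulC -residuation
     (le_trans (lex1 c))// residuation.
apply: (seq_up_le ua) => n.
by rewrite -(MV_divisible (seq_up_ge n ua)) le_rmul2l.
Qed.

(** For an upper bound [c], antitonicity gives [c ⇒ a <= (u n ⇒ a) ⇒ a = u n]. Hence [c ⇒ a <= a],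
    and [c = (c ⇒ a) ⇒ a] is [\top]. *)
Lemma MV_seq_down_rimp (u : nat -> A) a :
  seq_down u a -> seq_up (fun n => u n ⇒ a) \top.
Proof.
move=> ua; apply: seq_up_top => [m n mn|c uc].
  by apply: le_rimp2r; exact: ua.1.
have ac : a <= c by apply: le_trans (uc 0%N); exact: rimp_ge.
rewrite -(MV_rimpK ac); apply/eqP; rewrite rimp_top.
apply: (seq_down_ge ua) => n.
by rewrite -[X in _ <= X](MV_rimpK (seq_down_le n ua)) le_rimp2r.
Qed.

End MVAlgebraTheory.

Section States.
Context {d d' : Order.disp_t}.
Context {A : residuatedLatticeType d} {L : residuatedLatticeType d'}.
Variable s : A -> L.
Hypothesis s_state : type_I_state s.
Hypothesis s_op : order_preserving s.

Lemma state_rdist a b : a <= b -> rdist (s a) (s b) = s (b ⇒ a).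
Proof.
by case: s_state => _ _ sI ab; rewrite sI// rdist_le//; exact: s_op.
Qed.

(** Lets a sequence witnessing convergence at [\top] be read as a lower bound for the values of [s],
    and so be reused as a witness elsewhere. *)
Lemma state_rdist_top a : rdist (s a) (s \top) = s a.
Proof. by rewrite state_rdist ?lex1// top_rimp. Qed.

Lemma up_continuous_in_top : is_MV_algebra A ->
  up_continuous_in s \top -> up_continuous s.
Proof.
move=> A_MV s1 a u ua; have [c [c1 cs]] := s1 _ (MV_seq_up_rimp A_MV ua).
exists c; split=> // n; rewrite state_rdist; last exact: seq_up_ge ua.
by rewrite -state_rdist_top.
Qed.

Lemma down_continuous_of_up : is_MV_algebra A ->
  up_continuous_in s \top -> down_continuous s.
Proof.
move=> A_MV s1 a u ua; have [c [c1 cs]] := s1 _ (MV_seq_down_rimp A_MV ua).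
exists c; split=> // n; rewrite rdistC state_rdist; last exact: seq_down_le ua.
by rewrite -state_rdist_top.
Qed.

Lemma up_continuous_in_top_of_down : involutive_lattice L ->
  down_continuous_in s \bot -> up_continuous_in s \top.
Proof.
case: (s_state) => sb _ sI Linv s0 u u1.
have [c [c1 cs]] := s0 _ (seq_down_neg u1).
exists c; split=> // n; rewrite state_rdist_top.
(* Involutivity and [s (rneg x) = rneg (s x)] turn [s (u n)] into [rneg (s (rneg (u n)))], the left
   component of the distance from [s (rneg (u n))] to [s \bot]. *)
rewrite -[s (u n)]Linv {2}/rneg -sb -sI ?le0x//.
by apply: le_trans (cs n) _; rewrite /rdist sb leIl.
Qed.

End States.

Theorem proposition6p12 (d d' : Order.disp_t)
    (A : residuatedLatticeType d) (L : residuatedLatticeType d') (s : A -> L)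
    (A_MV : is_MV_algebra A) (s_state : type_I_state s)
    (s_op : order_preserving s) :
  [/\ up_continuous_in s \top%O <-> up_continuous s,
      up_continuous_in s \top%O -> down_continuous s,
      down_continuous s -> down_continuous_in s \bot%O &
      involutive_lattice L ->
      [<-> up_continuous_in s \top%O; up_continuous s;
           down_continuous_in s \bot%O; down_continuous s;
           state_continuous s]].
Proof.
have up := up_continuous_in_top s_state s_op A_MV.
have down := down_continuous_of_up s_state s_op A_MV.
split=> //.
move=> Linv; have top := up_continuous_in_top_of_down s_state s_op Linv.
tfae.
- exact: up.
- by move=> sup; apply: down; exact: sup.
(* Involutivity enters here and in the next step, each time to pass from [\bot] back to [\top]. *)
- by move=> /top /down.
- by move=> sdown a; split; [apply: up; apply: top|]; exact: sdown.
- by move=> scont; exact: (scont _).1.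
Qed.
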